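(* Let $\mathcal{G}$ be a proper subgroup (possibly trivial) of the icosahedral group $\mathcal{I}$, and let $d_{\mathcal{G}}$ be the degree of the $\mathcal{G}$-graph. Let $\mathcal{H}$ be a crystallographic representation of $\mathcal{I}$ in $B_6$. Then there are exactly $d_{\mathcal{G}}$ representations $\mathcal{K}_j \in \mathcal{C}_{B_6}(\hat{\mathcal{I}})$, $j=1,\ldots,d_{\mathcal{G}}$, such that $\mathcal{H}\cap \mathcal{K}_j = P_j$ for some $P_j \in \mathcal{C}_{B_6}(\mathcal{K}_{\mathcal{G}})$. In particular, $d_{\mathcal{G}} = 5, 6, 10, 0, 30, 20, 60$ and $60$ for $\mathcal{G}$ isomorphic to $\mathcal{T}, \mathcal{D}_{10}, \mathcal{D}_6, C_5, \mathcal{D}_4, C_3, C_2$ and $\{e\}$, respectively.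
   Context: $B_6 = O(6)\cap GL(6,\mathbb{Z})$ is the group of all $6\times 6$ signed permutation matrices. $\mathcal{I}\cong A_5$ is the (rotational) icosahedral group of order $60$, generated by $g_2,g_3$ with $g_2^2=g_3^3=(g_2g_3)^5=e$; $T_1,T_2$ are its two inequivalent $3$-dimensional real irreducible representations. A crystallographic representation of $\mathcal{I}$ in $B_6$ is a subgroup $\mathcal{H}\le B_6$ isomorphic to $\mathcal{I}$ whose natural action on $\mathbb{R}^6$ is equivalent in $GL(6,\mathbb{R})$ to $T_1\oplus T_2$. Let $\hat{\mathcal{I}}:\mathcal{I}\to B_6$ be the faithful representation determined on the standard basis $e_1,\dots,e_6$ of $\mathbb{R}^6$ by $\hat{\mathcal{I}}(g_2): e_1\mapsto e_6,\ e_2\mapsto e_5,\ e_3\mapsto -e_3,\ e_4\mapsto -e_4,\ e_5\mapsto e_2,\ e_6\mapsto e_1$ and $\hat{\mathcal{I}}(g_3): e_1\mapsto e_5,\ e_2\mapsto -e_3,\ e_3\mapsto -e_4,\ e_4\mapsto e_2,\ e_5\mapsto e_6,\ e_6\mapsto e_1$; its image, also denoted $\hat{\mathcal{I}}$, is a crystallographic representation of $\mathcal{I}$. For a subgroup $H$ of $B_6$, $\mathcal{C}_{B_6}(H)=\{gHg^{-1}:g\in B_6\}$. The set of all crystallographic representations of $\mathcal{I}$ in $B_6$ is $\mathcal{C}_{B_6}(\hat{\mathcal{I}})$. For a subgroup $\mathcal{G}\le\mathcal{I}$, $\mathcal{K}_{\mathcal{G}}:=\hat{\mathcal{I}}(\mathcal{G})\le\hat{\mathcal{I}}\le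 B_6$. The $\mathcal{G}$-graph is the simple graph with vertex set $\mathcal{C}_{B_6}(\hat{\mathcal{I}})$ in which two distinct vertices $\mathcal{H}_1,\mathcal{H}_2$ are adjacent iff $\mathcal{H}_1\cap\mathcal{H}_2\in\mathcal{C}_{B_6}(\mathcal{K}_{\mathcal{G}})$; it is a regular graph. Here $\mathcal{T}$ is the tetrahedral group (order $12$), $\mathcal{D}_{2n}$ the dihedral group of order $2n$, $C_n$ the cyclic group of order $n$. *)

(* Defs.v *)
From HB Require Import structures.
From mathcomp Require Import all_boot all_order all_algebra.
From mathcomp Require Import all_fingroup all_solvable all_character.
From mathcomp Require Import reals.

Set Implicit Arguments.
Unset Strict Implicit.
Unset Printing Implicit Defensive.

Import Order.TTheory GRing.Theory Num.Theory.
Local Open Scope ring_scope.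

(* B_n is the intersection of GL(n, Z) and O(n). *)
Record hyperoctahedral (n : nat) := Hyperoctahedral {
  hyperoct_mx :> 'M[int]_n;
  _ : (hyperoct_mx \in unitmx) && (hyperoct_mx *m hyperoct_mx^T == 1%:M)
}.

Notation "''B_' n" := (hyperoctahedral n)
  (at level 0, n at level 2, format "''B_' n") : type_scope.

Section HyperoctahedralGroup.

Variable n : nat.

HB.instance Definition _ := [isSub for @hyperoct_mx n].
HB.instance Definition _ := [Countable of 'B_n by <:].

Implicit Types A B C : 'B_n.

Lemma hyperoct_unitmx A : (A : 'M_n) \in unitmx.
Proof. by case/andP: (valP A). Qed.

Lemma hyperoct_mulmxT A : A *m (A : 'M_n)^T = 1%:M.
Proof. by case/andP: (valP A) => _ /eqP. Qed.

Lemma hyperoct_sqr_le1 A i j : (A i j) ^+ 2 <= 1.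
Proof.
have /matrixP/(_ i i) := hyperoct_mulmxT A.
rewrite !mxE eqxx mulr1n => <-; rewrite (bigD1 j) //= mxE -expr2 lerDl.
by apply: sumr_ge0 => k _; rewrite mxE -expr2 sqr_ge0.
Qed.

(* Entries lie in {-1, 0, 1}, so B_n embeds in a finite type of matrices. *)
Definition hyperoct_code A : 'M['I_3]_n :=
  map_mx (fun x => inord (absz (x + 1))) A.

Definition hyperoct_decode (M : 'M['I_3]_n) : option 'B_n :=
  insub (map_mx (fun k : 'I_3 => (k : nat)%:Z - 1) M).

Lemma hyperoct_codeK : pcancel hyperoct_code hyperoct_decode.
Proof.
move=> A; rewrite /hyperoct_decode.
suff -> : map_mx (fun k : 'I_3 => (k : nat)%:Z - 1) (hyperoct_code A) = A.
  by rewrite valK.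
apply/matrixP => i j; rewrite !mxE.
have := hyperoct_sqr_le1 A i j.
rewrite -real_normK ?num_real // expr_le1 // ler_norml => /andP[ge_m1 le1].
have x1_ge0 : 0 <= A i j + 1 by rewrite -lerBlDr sub0r.
rewrite inordK ?gez0_abs ?addrK //.
by rewrite -ltz_nat gez0_abs // (@le_lt_trans _ _ (1 + 1)) // lerD2r.
Qed.

HB.instance Definition _ : isFinite 'B_n := PCanIsFinite hyperoct_codeK.

Lemma hyperoct_mul_subproof A B :
  (A *m B \in unitmx) && (A *m B *m (A *m B)^T == 1%:M).
Proof.
rewrite unitmx_mul !hyperoct_unitmx /= trmx_mul -mulmxA (mulmxA (B : 'M_n)).
by rewrite hyperoct_mulmxT mul1mx hyperoct_mulmxT.
Qed.

Lemma hyperoct_one_subproof :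
  ((1%:M : 'M[int]_n) \in unitmx) &&
    (1%:M *m (1%:M : 'M[int]_n)^T == 1%:M).
Proof. by rewrite unitmx1 trmx1 mulmx1 /=. Qed.

Lemma hyperoct_inv_subproof A :
  ((A : 'M_n)^T \in unitmx) && ((A : 'M_n)^T *m (A : 'M_n)^T^T == 1%:M).
Proof.
by rewrite unitmx_tr hyperoct_unitmx trmxK (mulmx1C (hyperoct_mulmxT A)) /=.
Qed.

Definition hyperoct_mul A B := Hyperoctahedral (hyperoct_mul_subproof A B).
Definition hyperoct_one := Hyperoctahedral hyperoct_one_subproof.
Definition hyperoct_inv A := Hyperoctahedral (hyperoct_inv_subproof A).

Lemma hyperoct_mulA : associative hyperoct_mul.
Proof. by move=> A B C; apply/val_inj; rewrite /= mulmxA. Qed.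

Lemma hyperoct_mul1 : left_id hyperoct_one hyperoct_mul.
Proof. by move=> A; apply/val_inj; rewrite /= mul1mx. Qed.

Lemma hyperoct_mulV : left_inverse hyperoct_one hyperoct_inv hyperoct_mul.
Proof. by move=> A; apply/val_inj; rewrite /= (mulmx1C (hyperoct_mulmxT A)). Qed.

HB.instance Definition _ := Finite_isGroup.Build 'B_n
  hyperoct_mulA hyperoct_mul1 hyperoct_mulV.

End HyperoctahedralGroup.

Section IcosahedralGroup.

Variables (gT : finGroupType) (I : {group gT}).

Definition icosahedral_generators (g2 g3 : gT) : Prop :=
  [/\ I \isog 'Alt_('I_5), <<[set g2; g3]>>%g = I,
      (g2 ^+ 2 = 1)%g, (g3 ^+ 3 = 1)%g & ((g2 * g3) ^+ 5 = 1)%g].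

(* The basis of Z^6, numbered from 1; matrices act on column vectors. *)
Definition e6 (k : nat) : 'cV[int]_6 := \col_(i < 6) (i.+1 == k)%:R.

Definition icosahedral_images (A2 A3 : 'M[int]_6) : Prop :=
  [/\ A2 *m e6 1 = e6 6, A2 *m e6 2 = e6 5, A2 *m e6 3 = - e6 3,
      A2 *m e6 4 = - e6 4 & A2 *m e6 5 = e6 2 /\ A2 *m e6 6 = e6 1] /\
  [/\ A3 *m e6 1 = e6 5, A3 *m e6 2 = - e6 3, A3 *m e6 3 = - e6 4,
      A3 *m e6 4 = e6 2 & A3 *m e6 5 = e6 6 /\ A3 *m e6 6 = e6 1].

Section Crystallographic.

Variable R : realType.

Lemma hyperoct_repr_subproof n (phi : {morphism I >-> 'B_n}) :
  mx_repr I (fun g => map_mx intr (phi g : 'M[int]_n) : 'M[R]_n).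
Proof.
split=> [|x y Ix Iy]; first by rewrite morph1 map_mx1.
by rewrite morphM // -map_mxM.
Qed.

Definition hyperoct_repr n (phi : {morphism I >-> 'B_n}) :
  mx_representation R I n := MxRepresentation (hyperoct_repr_subproof phi).

Variables T1 T2 : mx_representation R I 3.

(* isom I H phi: phi is injective on I, with image H. Being about matrices up
   to similarity, mx_rsim does not depend on the row/column convention. *)
Definition crystallographic (H : {group 'B_6}) : Prop :=
  exists2 phi : {morphism I >-> 'B_6}, isom I H phi
    & mx_rsim (hyperoct_repr phi)
        (dadd_grepr (Representation T1) (Representation T2)).

End Crystallographic.

End IcosahedralGroup.

(* H :^ g is g^-1 H g; as g ranges over the whole group, this is also the set
   of all g H g^-1. *)
Definition conj_class (gT : finGroupType) (H : {set gT}) : {set {set gT}} :=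
  (H :^: [set: gT])%g.

Section Degree.

Variables (T : finType) (V : {set T}) (adj : rel T).

Definition degree (x : T) : nat := #|[set y in V | adj x y]|.

Definition regular_of_degree (d : nat) : Prop :=
  forall x, x \in V -> degree x = d.

End Degree.

(* Adjacency in the G-graph, where K is the image of G in B_6. *)
Definition Ggraph_adj (gT : finGroupType) (K : {set gT}) : rel {set gT} :=
  fun H1 H2 => (H1 != H2) && (H1 :&: H2 \in conj_class K).

(* Main.v *)
Require Import Defs.
From HB Require Import structures.
From mathcomp Require Import all_boot all_order all_algebra.
From mathcomp Require Import all_fingroup all_solvable all_character.
From mathcomp Require Import reals.

(** Let Io be the image of the icosahedral group in B_6, a group of order 60.
    Three facts carry the proof.

    Every crystallographic H is conjugate to Io ([conj_ico]). An irreducible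
    representation of degree 3 has no invariant line, hence neither has
    T1 (+) T2 ([dadd_no_line]). As |B_6| = 2^6 * 6! is divisible by 5 exactly
    once, Sylow's theorem lets one assume that H contains the standard
    five-fold rotation r of Io, so that H is generated by r and an involution a
    such that a * r^k has order 3 for some k prime to 5. Each such a either
    preserves, together with r, one of three explicit lines, or lies in Io, or
    lies in the conjugate of Io by diag(1,1,1,1,1,-1), which centralises r
    ([involution_cases]).

    The class of Io has 192 members ([class_ico]). The normaliser of Io has
    order at least 240, as it contains Io, -1 and a signed permutation inducing
    an outer automorphism, so there are at most 46080 / 240 = 192 conjugates;
    and 192 distinct ones are exhibited. Intersecting Io with each
    of them gives the list [meet_orders]: Io itself, then 5, 6, 10, 30, 20, 60
    and 60 intersections of order 12, 10, 6, 4, 3, 2 and 1, none of order 5.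

    Two subgroups of Io of the same order n, with n among 1, 2, 3, 4, 6, 10
    and 12, are conjugate ([sub_ico_conj]): unless trivial, such a subgroup is
    recovered from a suitable subgroup of prime order in it, as that subgroup
    itself, its centraliser, its normaliser, or the tetrahedral group around
    it. So meeting Io in a conjugate of K_G is the same as meeting Io in a
    subgroup of order |G|, and the degree of the G-graph at Io is a
    multiplicity in [meet_orders]. The graph is regular because B_6 permutes
    its vertices transitively; and since |G| < 60, excluding the vertex itself
    from its own neighbours changes nothing.

    The finite verifications are evaluated on signed permutations written as
    lists, with which the matrices of B_n are put in bijection. *)

Set Implicit Arguments.
Unset Strict Implicit.
Unset Printing Implicit Defensive.

Import Order.TTheory GRing.Theory Num.Theory.
Local Open Scope group_scope.

(** * Signed permutation matrices as lists *)

Section Codes.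
Variable n : nat.
Local Open Scope ring_scope.
Implicit Types (A B : 'B_n).

(** A row of an orthogonal matrix has norm 1, which leaves room for only one
    nonzero integer entry. *)
Lemma hyperoct_row_inj A (i j k : 'I_n) :
  A i j != 0 -> A i k != 0 -> j = k.
Proof.
have sqr_ge1 (x : int) : x != 0 -> 1 <= x ^+ 2.
  by move=> nz_x; rewrite -[1]add0r lezD1 lt0r sqrf_eq0 nz_x sqr_ge0.
move=> /sqr_ge1 Aij /sqr_ge1 Aik; apply/eqP/negPn/negP => neq_jk.
have /matrixP/(_ i i) := hyperoct_mulmxT A.
rewrite !mxE eqxx mulr1n (bigD1 j) // (bigD1 k) /= 1?eq_sym //.
rewrite !mxE -!expr2 addrA => sum1.
suff: (1 + 1 : int) <= 1 by [].
rewrite -[leRHS]sum1 -[leLHS]addr0 lerD ?lerD //.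
by apply: sumr_ge0 => l _; rewrite mxE -expr2 sqr_ge0.
Qed.

Lemma hyperoct_col_inj A (i k j : 'I_n) :
  A i j != 0 -> A k j != 0 -> i = k.
Proof.
by move=> Aij Akj; apply: (@hyperoct_row_inj A^-1%g j); rewrite /= mxE.
Qed.

Lemma hyperoct_col_ex A j : exists i, A i j != 0.
Proof.
apply/existsP; rewrite -[[exists _, _]]negbK negb_exists; apply/negP.
move=> /forallP A0; have /matrixP/(_ j j) := hyperoct_mulmxT A^-1%g.
rewrite !mxE eqxx big1 // => i _; rewrite !mxE.
by have := A0 i; rewrite negbK => /eqP ->; rewrite mul0r.
Qed.

Lemma hyperoct_sign A i j : A i j != 0 -> A i j = (-1) ^+ (A i j < 0)%R.
Proof.
move=> nzA; have := hyperoct_sqr_le1 A i j; move: (A i j) nzA => x nzx.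
rewrite -real_normK ?num_real // expr_le1 // => x1.
have norm_x: `|x| = 1 by apply/eqP; rewrite eq_le x1 -[1]add0r lezD1 normr_gt0.
by rewrite {1}[x]numEsign norm_x mulr1.
Qed.

(** The pair (i, s) in position j of a code says that column j is
    (-1)^s times the i-th basis vector, counted from 0. *)
Definition code_mx (c : seq (nat * bool)) : 'M[int]_n :=
  \matrix_(i, j) let p := nth (0, false)%N c j in
                 if p.1 == i then (-1) ^+ p.2 else 0.

Definition is_code (c : seq (nat * bool)) := perm_eq (unzip1 c) (iota 0 n).

Definition mulc (c d : seq (nat * bool)) :=
  [seq (let q := nth (0, false)%N c p.1 in (q.1, p.2 (+) q.2)) | p <- d].

Lemma size_code c : is_code c -> size c = n.
Proof. by move/perm_size; rewrite size_map size_iota. Qed.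

Lemma code_lt c j : is_code c -> (j < n)%N -> ((nth (0, false) c j).1 < n)%N.
Proof.
move=> cc lt_jn; have sz := size_code cc.
suff: (nth (0, false) c j).1 \in iota 0 n by rewrite mem_iota.
by rewrite -(perm_mem cc) map_f // mem_nth ?sz.
Qed.

Lemma code_inj c j k : is_code c -> (j < n)%N -> (k < n)%N ->
  (nth (0, false) c j).1 = (nth (0, false) c k).1 -> j = k.
Proof.
move=> cc lt_jn lt_kn; have sz := size_code cc.
rewrite -!(nth_map _ 0%N fst) ?sz // => /eqP.
rewrite nth_uniq ?size_map ?sz ?(perm_uniq cc) ?iota_uniq // => /eqP->//.
Qed.

Lemma code_mxM c d : is_code c -> is_code d ->
  code_mx (mulc c d) = code_mx c *m code_mx d.
Proof.
move=> cc cd; apply/matrixP => i j; rewrite !mxE /=.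
rewrite (bigD1 (Ordinal (code_lt cd (ltn_ord j)))) //= big1 => [|k neq_k].
  rewrite !mxE /= eqxx addr0 (nth_map (0%N, false)) ?(size_code cd) //=.
  by case: eqP; rewrite ?mul0r // mulrC -signr_addb.
rewrite !mxE /= [X in _ * X]ifN ?mulr0 //; apply: contra neq_k => /eqP def_k.
by apply/eqP/val_inj.
Qed.

Lemma code_mx_orth c : is_code c -> code_mx c *m (code_mx c)^T = 1%:M.
Proof.
move=> cc; apply/matrixP => i k; rewrite !mxE.
have [<-|neq_ik] := eqVneq i k; last first.
  rewrite big1 // => j _; rewrite !mxE /=.
  case: ifP; rewrite ?mul0r // => /eqP->.
  by rewrite val_eqE (negPf neq_ik) mulr0.
have: (i : nat) \in unzip1 c by rewrite (perm_mem cc) mem_iota /=.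
case/(nthP 0%N) => j; rewrite size_map => lt_j.
rewrite (nth_map (0%N, false)) //.
rewrite (size_code cc) in lt_j => def_i.
rewrite (bigD1 (Ordinal lt_j)) //= big1 => [|l neq_l].
  by rewrite !mxE /= def_i eqxx addr0 -expr2 sqrr_sign.
rewrite !mxE /= ifN ?mul0r //; apply: contra neq_l => /eqP def_i'.
by apply/eqP/val_inj/(code_inj cc (ltn_ord l) lt_j); rewrite def_i' def_i.
Qed.

Lemma code_mx_inj c d :
  is_code c -> is_code d -> code_mx c = code_mx d -> c = d.
Proof.
move=> cc cd eq_cd; apply: (@eq_from_nth _ (0, false)%N) => [|j].
  by rewrite !size_code.
rewrite (size_code cc) => lt_j; have lt_c := code_lt cc lt_j.
have /matrixP/(_ (Ordinal lt_c) (Ordinal lt_j)) := eq_cd.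
rewrite !mxE /= eqxx; case: eqP => [|_ /eqP]; last by rewrite signr_eq0.
case: (nth _ c j) (nth _ d j) => [i s] [k t] /= -> /eqP.
by case: s; case: t.
Qed.

Lemma code_ex A : exists c, is_code c && (code_mx c == A).
Proof.
pose f j := odflt j [pick i | A i j != 0].
have fP j : A (f j) j != 0.
  rewrite /f; case: pickP => //= A0; have [i] := hyperoct_col_ex A j.
  by rewrite A0.
pose c := [seq (f j : nat, (A (f j) j < 0)%R) | j <- enum 'I_n].
have uniq_f: uniq [seq val (f j) | j <- enum 'I_n].
  rewrite map_inj_uniq ?enum_uniq // => j k /val_inj eq_f.
  by apply: (@hyperoct_row_inj A (f j)) => //; rewrite eq_f.
exists c; apply/andP; split.
  rewrite /is_code /unzip1 /c -map_comp perm_sym uniq_perm ?iota_uniq //.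
  apply: fsym.
  have [_ /mapP[j _ ->]||_ //] := uniq_min_size uniq_f (s2 := iota 0 n).
    by rewrite mem_iota /=.
  by rewrite size_map size_iota size_enum_ord.
apply/eqP/matrixP => i j.
rewrite mxE (nth_map j) ?size_enum_ord // nth_ord_enum /=.
rewrite val_eqE; case: eqP => [<-|/eqP neq_i]; first by rewrite -hyperoct_sign.
apply/eqP; rewrite eq_sym.
by apply: contraR neq_i => /(hyperoct_col_inj (fP j))->.
Qed.

(** The inverse of [code_mx], total on B_n, so that the laws below carry no
    side conditions. *)
Definition enc A := xchoose (code_ex A).

Lemma enc_code A : is_code (enc A).
Proof. by case/andP: (xchooseP (code_ex A)). Qed.

Lemma encK A : code_mx (enc A) = A.
Proof. by case/andP: (xchooseP (code_ex A)) => _ /eqP. Qed.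

Lemma enc_inj : injective enc.
Proof.
by move=> A B eq_AB; apply: val_inj; rewrite /= -(encK A) eq_AB encK.
Qed.

Lemma mulc_code c d : is_code c -> is_code d -> is_code (mulc c d).
Proof.
move=> cc cd; apply/(perm_trans _ cc).
apply: (perm_trans (y := [seq (nth (0, false) c j).1 | j <- unzip1 d]))%N.
  by rewrite /mulc /unzip1 -!map_comp.
apply: perm_trans (perm_map _ cd) _.
rewrite -{2}[c](mkseq_nth (0, false)%N) /mkseq (size_code cc).
by rewrite /unzip1 -map_comp.
Qed.

Lemma enc_uniq A c : is_code c -> code_mx c = A -> enc A = c.
Proof. by move=> cc cA; apply: code_mx_inj; rewrite ?encK ?enc_code. Qed.

Lemma encM A B : enc (A * B)%g = mulc (enc A) (enc B).
Proof.
by apply: enc_uniq; rewrite ?mulc_code ?code_mxM ?encK ?enc_code.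
Qed.

Lemma enc_onto c : is_code c -> exists A, enc A = c.
Proof.
move=> cc; have orth := code_mx_orth cc; have [unit_c _] := mulmx1_unit orth.
have cP: (code_mx c \in unitmx) && (code_mx c *m (code_mx c)^T == 1%:M).
  by rewrite unit_c orth /=.
by exists (Hyperoctahedral cP); apply: enc_uniq.
Qed.

Definition onec := [seq (j, false) | j <- iota 0 n].

Lemma enc1 : enc 1%g = onec.
Proof.
apply: enc_uniq; first by rewrite /is_code /onec /unzip1 -map_comp map_id.
apply/matrixP => i j; rewrite !mxE (nth_map 0%N) ?size_iota // nth_iota //=.
by rewrite add0n [i == j]eq_sym -val_eqE; case: eqP.
Qed.

End Codes.

Section CodeGroup.
Variable n : nat.
Implicit Types (A B : 'B_n).

Definition invc (c : seq (nat * bool)) :=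
  [seq (let j := index i (unzip1 c) in (j, (nth (0, false) c j).2))
  | i <- iota 0 (size c)].

Definition conjc c d := mulc (invc d) (mulc c d).

Lemma invc_code c : is_code n c -> is_code n (invc c).
Proof.
move=> cc; rewrite /is_code /unzip1 /invc -map_comp.
have uc: uniq (unzip1 c) by rewrite (perm_uniq cc) iota_uniq.
rewrite (size_code cc) perm_sym.
suff iE: [seq index i (unzip1 c) | i <- unzip1 c] = iota 0 n.
  by rewrite -{1}iE; apply: perm_map.
apply: (@eq_from_nth _ 0) => [|j].
  by rewrite !size_map size_iota (size_code cc).
rewrite 2!size_map (size_code cc) => lt_j.
by rewrite (nth_map 0) ?index_uniq ?nth_iota ?size_map ?(size_code cc).
Qed.

Lemma mulcV c : is_code n c -> mulc c (invc c) = onec n.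
Proof.
move=> cc; rewrite /mulc /invc -map_comp (size_code cc); apply/eq_in_map => i.
rewrite -(perm_mem cc) => ci /=; rewrite addbb.
by rewrite -(nth_map _ 0 fst) ?nth_index // -(size_map fst) index_mem.
Qed.

Lemma encV A : enc A^-1 = invc (enc A).
Proof.
have [B encB] := enc_onto (invc_code (enc_code A)).
rewrite -encB; congr enc; apply/eqP; rewrite eq_invg_mul; apply/eqP.
by apply: enc_inj; rewrite encM encB mulcV ?enc_code ?enc1.
Qed.

Lemma encJ A B : enc (A ^ B) = conjc (enc A) (enc B).
Proof. by rewrite conjgE !encM encV. Qed.

Definition expc c k := iter k (mulc c) (onec n).

Lemma encX A k : enc (A ^+ k) = expc (enc A) k.
Proof. by elim: k => [|k IHk]; rewrite ?enc1 // expgS encM IHk. Qed.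

Lemma enc_eq A B : (enc A == enc B) = (A == B).
Proof. exact: inj_eq (@enc_inj n) A B. Qed.

Definition coded (s : seq (seq (nat * bool))) : {set 'B_n} :=
  [set A | enc A \in s].

Lemma card_coded s : uniq s -> all (is_code n) s -> #|coded s| = size s.
Proof.
move=> uniq_s /allP code_s; rewrite cardE -(size_map (@enc n)).
apply/perm_size/uniq_perm; rewrite ?(map_inj_uniq (@enc_inj n)) ?enum_uniq //.
move=> c; apply/mapP/idP=> [[A] | s_c]; first by rewrite mem_enum inE => sA ->.
by have [A eA] := enc_onto (code_s c s_c); exists A; rewrite ?mem_enum ?inE eA.
Qed.

Fixpoint bit_words k := if k is k'.+1 then
   [seq b :: w | b <- [:: false; true], w <- bit_words k'] else [:: [::]].

Lemma mem_bit_words k w : (w \in bit_words k) = (size w == k).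
Proof.
elim: k w => [|k IHk] [|b w]; rewrite ?inE //.
  by apply/negP => /allpairsP[[b w] []].
rewrite eqSS -IHk; apply/allpairsP/idP => [[[b1 w1] /= [_ ? [_ ->//]]] | kw].
by exists (b, w); case: b.
Qed.

Lemma bit_words_uniq k : uniq (bit_words k).
Proof.
elim: k => //= k IHk.
apply: (@allpairs_uniq _ _ _ (fun b w => b :: w) [:: false; true]) => //.
by move=> [b w] [b1 w1] _ _ [-> ->].
Qed.

Lemma size_bit_words k : size (bit_words k) = (2 ^ k)%N.
Proof.
elim: k => // k IHk.
rewrite (@size_allpairs _ _ _ (fun b w => b :: w) [:: false; true]).
by rewrite IHk expnS.
Qed.

Definition codes :=
  [seq zip p s | p <- permutations (iota 0 n), s <- bit_words n].

Lemma mem_codes c : (c \in codes) = is_code n c.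
Proof.
apply/allpairsP/idP => [[[p s] /= [pn sn ->]] | cc].
  rewrite mem_permutations in pn; rewrite mem_bit_words in sn.
  by rewrite /is_code unzip1_zip // (perm_size pn) size_iota (eqP sn).
exists (unzip1 c, unzip2 c) => /=.
rewrite mem_permutations [perm_eq _ _]cc mem_bit_words size_map (size_code cc).
by rewrite eqxx zip_unzip.
Qed.

Lemma codes_uniq : uniq codes.
Proof.
apply: allpairs_uniq; rewrite ?permutations_uniq ?bit_words_uniq //.
have sz u :
    u \in [seq (p, s) | p <- permutations (iota 0 n), s <- bit_words n] ->
  size u.1 = size u.2.
  case/allpairsP=> [[p s] /= [pn sn ->]] /=.
  rewrite mem_permutations in pn; rewrite mem_bit_words in sn.
  by rewrite (perm_size pn) size_iota (eqP sn).
move=> [p s] [q t] /sz /= sz_p /sz /= sz_q eq_z.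
have -> : p = q.
  by rewrite -[p](unzip1_zip (t := s)) ?sz_p // eq_z unzip1_zip ?sz_q.
by rewrite -[s](unzip2_zip (s := p)) ?sz_p // eq_z unzip2_zip ?sz_q.
Qed.

Lemma card_hyperoctahedral : #|[set: 'B_n]| = (n`! * 2 ^ n)%N.
Proof.
have -> : [set: 'B_n] = coded codes.
  by apply/setP => A; rewrite !inE mem_codes enc_code.
rewrite card_coded ?codes_uniq //; last by apply/allP => c; rewrite mem_codes.
rewrite size_allpairs size_permutations ?iota_uniq //.
by rewrite size_iota size_bit_words.
Qed.

End CodeGroup.

(** * The icosahedral data *)

Section IcosahedralData.
Local Open Scope nat_scope.

(** One-line notation: vectors are numbered from 1, and the second list marks
    by a 1 the columns with a minus sign. *)
Definition signed_perm (p s : seq nat) : seq (nat * bool) :=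
  zip [seq k.-1 | k <- p] [seq k == 1%N | k <- s].

Definition code_g2 := signed_perm [:: 6; 5; 3; 4; 2; 1] [:: 0; 0; 1; 1; 0; 0].
Definition code_g3 := signed_perm [:: 5; 3; 4; 2; 6; 1] [:: 0; 1; 1; 0; 0; 0].

(** The product is e1 -> e2 -> e3 -> e4 -> e5 -> e1, with e6 fixed and without
    signs: a rotation of order 5 whose invariant lines are visible. *)
Definition code_g5 := mulc code_g2 code_g3.

(** Every rotation is a word of length at most 12 in the two generators. *)
Definition icosa_list := Eval vm_compute in
  iter 12 (fun s => undup (s ++ [seq mulc g c | g <- [:: code_g2; code_g3],
                                                c <- s]))
    [:: onec 6].

(** Locked so that rewriting never unfolds membership into sixty cases. *)
Definition icosa := locked icosa_list.

Lemma icosaE : icosa = icosa_list. Proof. by rewrite /icosa -lock. Qed.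

Lemma icosa_uniq : uniq icosa.
Proof. by rewrite icosaE; vm_compute. Qed.

Lemma size_icosa : size icosa = 60.
Proof. by rewrite icosaE; vm_compute. Qed.

Lemma icosa_code : {in icosa, forall c, is_code 6 c}.
Proof. by apply/allP; rewrite icosaE; vm_compute. Qed.

Lemma icosa_gens : [/\ onec 6 \in icosa, code_g2 \in icosa & code_g3 \in icosa].
Proof. by rewrite icosaE; split; vm_compute. Qed.

Lemma icosa_mul : {in icosa &, forall c d, mulc c d \in icosa}.
Proof.
have mulP: all (fun c => all (fun d => mulc c d \in icosa) icosa) icosa.
  by rewrite icosaE; vm_compute.
by move=> c d Ic; apply: (allP (allP mulP c Ic)).
Qed.

(** diag(1,1,1,1,1,-1): it commutes with [code_g5] but does not normalise the
    icosahedral group, so it yields a second conjugate through the same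
    five-fold rotation. *)
Definition flip_code :=
  signed_perm [:: 1; 2; 3; 4; 5; 6] [:: 0; 0; 0; 0; 0; 1].

Definition neg_code :=
  signed_perm [:: 1; 2; 3; 4; 5; 6] [:: 1; 1; 1; 1; 1; 1].

(** It carries [code_g5] to its square up to inversion, hence induces an outer
    automorphism of the icosahedral group. *)
Definition outer_code :=
  signed_perm [:: 1; 3; 5; 2; 4; 6] [:: 1; 1; 1; 1; 1; 0].

Definition norm_reps :=
  [:: onec 6; neg_code; outer_code; mulc neg_code outer_code].

Definition norm_codes := locked [seq mulc d c | d <- norm_reps, c <- icosa].

Lemma norm_codesP :
  [&& size norm_codes == 240, uniq norm_codes, all (is_code 6) norm_codes,
      all (is_code 6) norm_reps &
      all (fun d => all (fun c => conjc c d \in icosa) icosa) norm_reps].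
Proof. by rewrite /norm_codes -lock icosaE; vm_compute. Qed.

(** Coset representatives of the normaliser. It contains -1, and acts on the
    six axes as PGL(2,5) does on the projective line over the field with five
    elements, sharply 3-transitively: modulo the normaliser one may fix the
    first three axes and the sign of e1. *)
Definition transversal :=
  locked [seq zip [:: 0, 1, 2 & p] (false :: w)
         | p <- permutations [:: 3; 4; 5], w <- bit_words 5].

Lemma transversal_codesP :
  [&& size transversal == 192, uniq transversal, all (is_code 6) transversal &
      pairwise (fun c d => let e := mulc c (invc d) in
        if conjc code_g2 e \in icosa
        then conjc code_g3 e \notin icosa else true)
      transversal].
Proof. by rewrite /transversal -lock icosaE; vm_compute. Qed.

Definition meet_codes c := [seq x <- icosa | conjc x (invc c) \in icosa].

(** The orders of the intersections of the icosahedral group with its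
    conjugates; the entry 60 is the group met with itself. *)
Definition meet_orders :=
  60 :: nseq 5 12 ++ nseq 6 10 ++ nseq 10 6 ++ nseq 30 4 ++ nseq 20 3
     ++ nseq 60 2 ++ nseq 60 1.

Lemma meet_orders_transversal :
  perm_eq [seq size (meet_codes c) | c <- transversal] meet_orders.
Proof. by rewrite /transversal /meet_codes -lock icosaE; vm_compute. Qed.

(** Row vectors, on which matrices act from the right. *)
Definition row_act (v : seq int) (c : seq (nat * bool)) :=
  [seq (let x := nth 0%R v p.1 in if p.2 then (- x)%R else x) | p <- c].

Definition keeps_line_code v c :=
  (row_act v c == v) || (row_act v c == [seq (- x)%R | x : int <- v]).

(** If a copy of the alternating group of degree 5 through [code_g5] has an
    invariant line, it has one of these: the fixed axis when it permutes the
    axes in orbits of sizes 5 and 1, and the trivial constituent of a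
    permutation representation, up to the sign of e6, when it permutes them
    transitively. *)
Definition test_lines : seq (seq int) :=
  [:: [:: 0; 0; 0; 0; 0; 1]; [:: 1; 1; 1; 1; 1; 1]; [:: 1; 1; 1; 1; 1; -1]]%R.

(** The involutions that can accompany a power of [code_g5] in a copy of the
    icosahedral group: those of the two crystallographic groups through
    [code_g5], and those preserving a line that [code_g5] preserves too. *)
Lemma involution_cases :
  all (fun a => [|| a \in icosa, conjc a flip_code \in icosa
                  | has (keeps_line_code^~ a) test_lines])
    [seq a <- [seq a <- codes 6 | mulc a a == onec 6]
       | has (fun k => expc 6 (mulc a (expc 6 code_g5 k)) 3 == onec 6)
             [:: 1; 2; 3; 4]].
Proof. by rewrite icosaE; vm_compute. Qed.

Lemma test_lines_g5 : all (keeps_line_code^~ code_g5) test_lines.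
Proof. by vm_compute. Qed.

Lemma conj_flip_g5 : conjc code_g5 flip_code = code_g5.
Proof. by apply/eqP; vm_compute. Qed.

Definition codes_of_order p :=
  [seq c <- icosa | (expc 6 c p == onec 6) && (c != onec 6)].

Definition cent_codes c := [seq z <- icosa | mulc z c == mulc c z].

Definition conj_to_power p r c :=
  has (fun d => has (fun k => conjc c d == expc 6 r k) (iota 0 p)) icosa.

Lemma prime_order_codes_conj :
  [/\ all (conj_to_power 2 code_g2) (codes_of_order 2),
      all (conj_to_power 3 code_g3) (codes_of_order 3) &
      all (conj_to_power 5 code_g5) (codes_of_order 5)].
Proof.
by rewrite /codes_of_order /conj_to_power icosaE; split; vm_compute.
Qed.

Lemma card_norm_codes :
  all (fun p => all (fun c =>
      count (fun z => has (fun k => conjc c z == expc 6 c k) (iota 0 p)) icosa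
        == p.*2)
    (codes_of_order p)) [:: 3; 5].
Proof. by rewrite /codes_of_order icosaE; vm_compute. Qed.

Lemma card_cent_codes :
  all (fun c => size (cent_codes c) == 4) (codes_of_order 2).
Proof. by rewrite /codes_of_order /cent_codes icosaE; vm_compute. Qed.

Lemma card_tetra_codes :
  all (fun c =>
      count (fun z =>
          all (fun v => expc 6 (mulc v z) 12 == onec 6) (cent_codes c)) icosa
        == 12)
    (codes_of_order 2).
Proof. by rewrite /codes_of_order /cent_codes icosaE; vm_compute. Qed.

End IcosahedralData.

(** * The icosahedral group and its conjugates *)

Lemma ico_group_set : group_set (coded 6 icosa : {set 'B_6}).
Proof.
have [one_ico _ _] := icosa_gens.
apply/group_setP; split=> [|x y]; first by rewrite in_set enc1.
by rewrite !in_set encM; apply: icosa_mul.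
Qed.

Definition ico : {group 'B_6} := locked (group ico_group_set).

Lemma mem_ico x : (x \in ico) = (enc x \in icosa).
Proof. by rewrite /ico -lock in_set. Qed.

Lemma ico_ex c : c \in icosa -> exists2 x, x \in ico & enc x = c.
Proof.
move=> Ic; have [x ex] := enc_onto (icosa_code Ic).
by exists x; rewrite ?mem_ico ?ex.
Qed.

Lemma ico_rot5 : exists2 r, r \in ico & enc r = code_g5.
Proof. by have [_ I2 I3] := icosa_gens; apply/ico_ex/icosa_mul. Qed.

Lemma card_coded_ico (Q : pred (seq (nat * bool))) :
  #|coded 6 [seq c <- icosa | Q c]| = count Q icosa.
Proof.
rewrite card_coded ?filter_uniq ?icosa_uniq ?size_filter //.
by apply/allP => c; rewrite mem_filter => /andP[_ /icosa_code].
Qed.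

Lemma card_ico_set (P : pred 'B_6) (Q : pred (seq (nat * bool))) :
  (forall x, x \in ico -> P x = Q (enc x)) ->
  #|[set x in ico | P x]| = count Q icosa.
Proof.
move=> PQ; rewrite -card_coded_ico; apply: eq_card => x.
rewrite inE [RHS]inE mem_filter -mem_ico andbC.
by case Ix: (x \in ico); rewrite ?andbF ?PQ.
Qed.

Lemma card_ico : #|ico| = 60.
Proof.
rewrite /ico -lock card_coded ?icosa_uniq ?size_icosa //.
by apply/allP/icosa_code.
Qed.

Lemma ico_gen (x y : 'B_6) :
    enc x = code_g2 -> enc y = code_g3 -> #|<<[set x; y]>>| = 60 ->
  <<[set x; y]>> = ico.
Proof.
move=> ex ey cxy; have [_ I2 I3] := icosa_gens.
apply/eqP; rewrite eqEcard card_ico cxy leqnn gen_subG subUset !sub1set.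
by rewrite !mem_ico ex ey I2 I3.
Qed.

Lemma card_B6 : #|[set: 'B_6]| = 46080.
Proof. by rewrite card_hyperoctahedral. Qed.

Lemma card_norm_ico : 240 <= #|'N(ico)|.
Proof.
have /and5P[/eqP sN uN cN /allP cD /allP normN] := norm_codesP.
rewrite -sN -(card_coded uN cN); apply/subset_leq_card/subsetP => z.
rewrite in_set /norm_codes -lock => /allpairsP[[d c] /= [Dd Ic ez]].
have [x Ix ex] := ico_ex Ic; have [y ey] := enc_onto (cD d Dd).
have -> : z = y * x by apply: enc_inj; rewrite encM ex ey.
rewrite groupM ?(subsetP (normG ico) x) //.
rewrite inE; apply/subsetP => _ /imsetP[t It ->].
by rewrite mem_ico encJ ey (allP (normN d Dd)) // -mem_ico.
Qed.

Definition transversal_set : {set 'B_6} := coded 6 transversal.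

Lemma mem_icoJ (r x : 'B_6) :
  (x \in ico :^ r) = (conjc (enc x) (invc (enc r)) \in icosa).
Proof. by rewrite mem_conjg mem_ico encJ encV. Qed.

(** If two representatives r, s gave the same conjugate, then r * s^-1 would
    carry both generators into the icosahedral group. *)
Lemma transversal_inj : {in transversal_set &, injective (fun r => ico :^ r)}.
Proof.
have /and4P[_ uT _ /(pairwiseP [::]) distT] := transversal_codesP.
have [_ I2 I3] := icosa_gens.
have mem2 (r s x : 'B_6) : ico :^ r = ico :^ s -> x \in ico ->
    conjc (enc x) (mulc (enc r) (invc (enc s))) \in icosa.
  move=> eq_rs Ix; rewrite -encV -encM -encJ -mem_ico conjgM -mem_conjg.
  by rewrite -eq_rs memJ_conjg.
pose pos (r : 'B_6) := index (enc r) transversal.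
move=> r s; wlog lt_rs: r s / pos r < pos s.
  move=> wlg Tr Ts eq_rs; have [lt_rs | lt_sr | eq_i] := ltngtP (pos r) (pos s).
  - exact: wlg.
  - by apply/esym/wlg.
  apply/enc_inj; rewrite !inE in Tr Ts.
  by rewrite -(nth_index [::] Tr) [index _ _]eq_i nth_index.
rewrite !inE => Tr Ts eq_rs.
have := distT _ _ _ _ lt_rs.
rewrite !inE !index_mem !nth_index // => /(_ Tr Ts).
have [x2 Ix2 e2] := ico_ex I2; have [x3 Ix3 e3] := ico_ex I3.
by rewrite -e2 -e3 /= !(mem2 r s).
Qed.

(** The 192 conjugates exhibited exhaust the class, since the normaliser has
    index at most 46080 / 240 = 192. *)
Lemma class_ico : conj_class ico = [set ico :^ r | r in transversal_set].
Proof.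
apply/esym/eqP; rewrite eqEcard; apply/andP; split.
  by apply/subsetP => _ /imsetP[r _ ->]; rewrite imset_f ?inE.
have /and4P[/eqP sT uT cT _] := transversal_codesP.
rewrite (card_in_imset transversal_inj) card_coded // sT.
have := Lagrange (subsetT 'N(ico)); rewrite card_B6 => cN.
rewrite /conj_class card_conjugates setTI -(leq_pmul2l (cardG_gt0 'N(ico))) cN.
by rewrite -[46080]/(240 * 192)%N leq_mul2r card_norm_ico.
Qed.

Lemma card_meet_ico n :
  #|[set K in conj_class ico | #|ico :&: K| == n]| = count_mem n meet_orders.
Proof.
have /and4P[_ uT cT _] := transversal_codesP.
have meetE r : #|ico :&: (ico :^ r)| = size (meet_codes (enc r)).
  rewrite size_filter -card_coded_ico; apply: eq_card => x.
  by rewrite in_setI [RHS]in_set mem_filter mem_ico mem_icoJ andbC.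
rewrite -(seq.permP meet_orders_transversal) count_map -size_filter.
rewrite -(@card_coded 6) ?filter_uniq //; last first.
  by apply/allP => c; rewrite mem_filter => /andP[_ /(allP cT)].
rewrite -(card_in_imset (D := coded 6 _) (f := fun r => ico :^ r)); last first.
  by apply: sub_in2 transversal_inj => r; rewrite !inE mem_filter => /andP[].
apply: eq_card => K; rewrite !inE class_ico; apply/andP/imsetP.
  case=> /imsetP[r Tr ->]; rewrite meetE => rn; exists r => //.
  by rewrite inE mem_filter /= rn; rewrite inE in Tr.
case=> r; rewrite inE mem_filter /= => /andP[rn Tr] ->.
by rewrite meetE rn imset_f // inE.
Qed.

(** * Subgroups of the icosahedral group of a given order *)

Lemma mem_codes_of_order p (x : 'B_6) :
  prime p -> x \in ico -> #[x] = p -> enc x \in codes_of_order p.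
Proof.
move=> p_pr Ix ox; rewrite mem_filter -mem_ico Ix -encX -enc1 !enc_eq.
by rewrite -ox expg_order eqxx -order_eq1 ox gtn_eqF ?prime_gt1.
Qed.

(** Subgroups of prime order are conjugate, because every element of order p
    is conjugate to a power of a fixed one. *)
Lemma cycle_ico_conj p (x y : 'B_6) : p \in [:: 2; 3; 5] ->
  x \in ico -> y \in ico -> #[x] = p -> #[y] = p ->
  exists2 g, g \in ico & <[y]> = <[x]> :^ g.
Proof.
move=> p235; have p_pr: prime p by move: p235; rewrite !inE => /or3P[]/eqP->.
have [c Ic /allP conj_c] : exists2 c, c \in icosa &
    all (conj_to_power p c) (codes_of_order p).
  have [[_ I2 I3] [ch2 ch3 ch5]] := (icosa_gens, prime_order_codes_conj).
  move: p235; rewrite !inE => /or3P[]/eqP->; last exists code_g5 => //.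
  - by exists code_g2.
  - by exists code_g3.
  by apply: icosa_mul.
have [r Ir er] := ico_ex Ic.
have conj_r z : z \in ico -> #[z] = p -> exists2 d, d \in ico & z ^ d \in <[r]>.
  move=> Iz /(mem_codes_of_order p_pr Iz)/conj_c/hasP[e Ie /hasP[k _]].
  have [d Id <-] := ico_ex Ie; rewrite -er -encJ -encX enc_eq => /eqP zd.
  by exists d; rewrite // zd mem_cycle.
move=> Ix Iy ox oy; have [d Id xd] := conj_r x Ix ox.
have [e Ie ye] := conj_r y Iy oy.
exists (d * e^-1); first by rewrite groupM ?groupV.
apply: (@conjsg_inj _ e); rewrite -conjsgM mulgKV -!cycleJ; apply/eqP.
rewrite (eq_subG_cyclic (cycle_cyclic r)) ?cycle_subG //.
by rewrite -!orderE !orderJ ox oy.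
Qed.

Lemma card_cent_ico (x : 'B_6) : x \in ico -> #[x] = 2 -> #|'C_ico[x]| = 4.
Proof.
move=> Ix ox; have oc := mem_codes_of_order (isT : prime 2) Ix ox.
rewrite -[RHS](eqP (allP card_cent_codes _ oc)).
rewrite size_filter -(card_ico_set (P := fun z => z \in 'C[x])) => [|z _].
  by apply: eq_card => z; rewrite !(in_setI, in_set).
by rewrite -!encM enc_eq; apply/cent1P/eqP.
Qed.

Lemma card_norm_ico_cycle p (x : 'B_6) :
    p \in [:: 3; 5] -> x \in ico -> #[x] = p ->
  #|'N_ico(<[x]>)| = p.*2.
Proof.
move=> p35 Ix ox; have p_pr: prime p by move: p35; rewrite !inE => /orP[]/eqP->.
have oc := mem_codes_of_order p_pr Ix ox.
rewrite -[RHS](eqP (allP (allP card_norm_codes p p35) _ oc)).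
rewrite -(card_ico_set (P := fun z => z \in 'N(<[x]>))) => [|z _].
  by apply: eq_card => z; rewrite !(in_setI, in_set).
rewrite inE -cycleJ cycle_subG.
apply/idP/hasP => [/cyclePmin[k lt_k xz] | [k _]].
  by exists k; rewrite ?mem_iota -?ox // -encJ xz encX.
by rewrite -encJ -encX enc_eq => /eqP->; apply: mem_cycle.
Qed.

(** For X of order 2, whose centraliser is a Klein four-group V, this is the
    tetrahedral group normalising V: any coset V z outside it contains an
    element of order 5. *)
Definition tetra (X : {set 'B_6}) :=
  [set z in ico | [forall v in 'C_ico(X), (v * z) ^+ 12 == 1]].

Lemma card_tetra (x : 'B_6) : x \in ico -> #[x] = 2 -> #|tetra <[x]>| = 12.
Proof.
move=> Ix ox; have oc := mem_codes_of_order (isT : prime 2) Ix ox.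
rewrite -[RHS](eqP (allP card_tetra_codes _ oc)).
pose P z := [forall v in 'C_ico(<[x]>), (v * z) ^+ 12 == 1].
rewrite -(card_ico_set (P := P)) => // z _; rewrite /P.
apply/forall_inP/allP => [zC c | zC v].
  rewrite mem_filter => /andP[cx Ic]; have [v Iv ev] := ico_ex Ic.
  rewrite -ev -!encM enc_eq in cx.
  rewrite -ev -encM -encX -enc1 enc_eq; apply: zC.
  by rewrite inE Iv cent_cycle; apply/cent1P/eqP.
rewrite inE cent_cycle => /andP[Iv /cent1P vx].
rewrite -enc_eq encX encM enc1; apply: zC.
by rewrite mem_filter -mem_ico Iv -!encM vx eqxx.
Qed.

(** A subgroup of order n contains a subgroup X of prime order from which it
    is recovered by this formula. *)
Definition sub_of_order n (X : {set 'B_6}) : {set 'B_6} :=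
  if n \in [:: 2; 3] then X else if n == 4 then 'C_ico(X)
  else if n == 12 then tetra X else 'N_ico(X).

Lemma sub_of_orderJ n X g :
  g \in ico -> sub_of_order n (X :^ g) = sub_of_order n X :^ g.
Proof.
move=> Ig; have IE : ico :^ g = ico :> {set _} by rewrite conjGid.
rewrite /sub_of_order; case: ifP => // _; case: ifP => _.
  by rewrite conjIg IE centJ.
case: ifP => _; last by rewrite conjIg IE normJ.
have CE: 'C_ico(X :^ g) = 'C_ico(X) :^ g by rewrite conjIg IE centJ.
apply/setP => z; rewrite mem_conjg !in_set (groupJr _ (groupVr Ig)).
apply: andb_id2l => _.
apply/forall_inP/forall_inP => [zC v Cv | zC v].
  have Cvg: v ^ g \in 'C_ico(X :^ g) by rewrite CE memJ_conjg.
  by rewrite -(conjgK g v) -conjMg -conjXg (eqP (zC _ Cvg)) conj1g.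
rewrite CE mem_conjg => /zC /eqP vz.
by rewrite -(inj_eq (conjg_inj g^-1)) conjXg conjMg vz conj1g.
Qed.

(** In orders 6 and 10 the Sylow 3- or 5-subgroup has index 2, hence is normal,
    and its normaliser has the right order. In orders 4 and 12 a Sylow
    2-subgroup has order 4, is abelian, and therefore equals the centraliser
    of any involution in it; in order 12 the exponent then puts the subgroup
    inside [tetra]. *)
Lemma sub_ico_of_order n (J : {group 'B_6}) :
    J \subset ico -> #|J| = n -> n \in [:: 2; 3; 4; 6; 10; 12] ->
  exists x, [/\ x \in ico,
    #[x] = (if n \in [:: 3; 6] then 3 else if n == 10 then 5 else 2)%N
    & J :=: sub_of_order n <[x]>].
Proof.
move=> sJI cJ n_in.
have prime_case p : prime p -> n = p ->
    exists x, [/\ x \in ico, #[x] = p & J :=: <[x]>].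
  move=> p_pr np; have [|x Jx ox] := @Cauchy _ p J p_pr; first by rewrite cJ np.
  exists x; split; rewrite ?(subsetP sJI) //.
  by apply/eqP; rewrite eq_sym eqEcard cycle_subG Jx cJ np -ox leqnn.
have norm_case p : p \in [:: 3; 5] -> n = p.*2 ->
    exists x, [/\ x \in ico, #[x] = p & J :=: 'N_ico(<[x]>)].
  move=> p35 np; have p_pr: prime p by move: p35; rewrite !inE => /orP[]/eqP->.
  have [|x Jx ox] := @Cauchy _ p J p_pr.
    by rewrite cJ np -muln2 dvdn_mulr.
  have Ix := subsetP sJI x Jx; exists x; split=> //.
  apply/eqP; rewrite eqEcard (card_norm_ico_cycle p35) // cJ np leqnn andbT.
  rewrite subsetI sJI normal_norm // index2_normal ?cycle_subG //.
  rewrite -divgS ?cycle_subG // cJ np -orderE ox -muln2 mulKn //.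
  exact: prime_gt0.
have cent_case (P : {group 'B_6}) : P \subset ico -> #|P| = 4 ->
    exists x, [/\ x \in ico, #[x] = 2 & P :=: 'C_ico(<[x]>)].
  move=> sPI cP; have [|x Px ox] := @Cauchy _ 2 P isT; first by rewrite cP.
  have Ix := subsetP sPI x Px; exists x; split=> //.
  apply/eqP; rewrite eqEcard cent_cycle card_cent_ico // cP leqnn andbT.
  rewrite subsetI sPI -cent_cycle centsC cycle_subG.
  by rewrite (subsetP (_ : abelian P)) // (@card_p2group_abelian _ 2).
move: n_in; rewrite /sub_of_order !inE => /or4P[|||/or3P[]] /eqP def_n.
- by have [|x xP] := prime_case 2 _ def_n; last by exists x; rewrite def_n.
- by have [|x xP] := prime_case 3 _ def_n; last by exists x; rewrite def_n.
- by have [//||x xP] := cent_case J; [rewrite cJ | exists x; rewrite def_n].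
- by have [||x xP] := norm_case 3; last by exists x; rewrite def_n.
- by have [||x xP] := norm_case 5; last by exists x; rewrite def_n.
have [P sylP] := Sylow_exists 2 J; have sPJ := pHall_sub sylP.
have [||x [Ix ox defP]] := cent_case P; first exact: subset_trans sPJ sJI.
  by rewrite (card_Hall sylP) cJ def_n p_part.
exists x; rewrite def_n; split=> //=.
apply/eqP; rewrite eqEcard card_tetra // cJ def_n leqnn andbT.
apply/subsetP => z Jz; rewrite in_set (subsetP sJI) //=.
apply/forall_inP => v; rewrite -defP => Pv.
by rewrite -def_n -cJ expg_cardG // groupM // (subsetP sPJ).
Qed.

Lemma sub_ico_conj n (J1 J2 : {group 'B_6}) :
    J1 \subset ico -> J2 \subset ico -> #|J1| = n -> #|J2| = n ->
    n \in [:: 1%N; 2; 3; 4; 6; 10; 12] ->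
  (J2 : {set 'B_6}) \in conj_class J1.
Proof.
move=> sJ1 sJ2 c1 c2; rewrite in_cons => /orP[/eqP n1 | n_in].
  rewrite (card1_trivg (etrans c1 n1)) (card1_trivg (etrans c2 n1)).
  by apply/imsetP; exists 1; rewrite ?inE // conjsg1.
have [x [Ix ox ->]] := sub_ico_of_order sJ1 c1 n_in.
have [y [Iy oy ->]] := sub_ico_of_order sJ2 c2 n_in.
have [|g Ig ->] := cycle_ico_conj _ Ix Iy ox oy.
  by case: ifP => _; [|case: ifP => _].
by rewrite sub_of_orderJ //; apply/imsetP; exists g; rewrite ?inE.
Qed.

(** * Crystallographic representations *)

Section Lines.
Local Open Scope ring_scope.

Lemma irr_no_line (F : fieldType) (gT : finGroupType) (G : {group gT}) n
    (rG : mx_representation F G n) (w : 'rV_n) :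
  mx_irreducible rG -> (1 < n)%N -> mxmodule rG w -> w = 0.
Proof.
move=> /mx_irrP[_ irrG] n_gt1 modw; apply: contraTeq n_gt1 => nzw.
have: row_full <<w>>%MS.
  by apply: irrG; rewrite ?(eqmx_module _ (genmxE _)) ?(eqmx_eq0 (genmxE _)).
by rewrite /row_full genmxE -leqNgt => /eqP <-; apply: rank_leq_row.
Qed.

(** The components of an invariant line in the two summands are invariant. *)
Lemma dadd_no_line (F : fieldType) (gT : finGroupType) (G : {group gT}) n n1 n2
    (rG : mx_representation F G n) (T1 : mx_representation F G n1)
    (T2 : mx_representation F G n2) (w : 'rV_n) :
    mx_irreducible T1 -> (1 < n1)%N -> mx_irreducible T2 -> (1 < n2)%N ->
    mx_rsim rG (dadd_grepr (Representation T1) (Representation T2)) ->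
  mxmodule rG w -> w = 0.
Proof.
move=> irr1 n1_gt1 irr2 n2_gt1 [B _ freeB homB] /mxmoduleP modw.
have wE x : x \in G ->
    exists a, w *m B *m block_mx (T1 x) 0 0 (T2 x) = a *: (w *m B).
  move=> Gx; have /sub_rVP[a wx] := modw x Gx; exists a.
  by rewrite scalemxAl -wx -!mulmxA (homB x Gx).
suff wB0: w *m B = 0 by apply/eqP; rewrite -(mulmx_free_eq0 w freeB) wB0.
move: (w *m B) wE => u uE.
rewrite -[u](@hsubmxK _ _ n1 n2) in uE *.
have line_i i (T : mx_representation F G i) (v : 'rV_i) :
    mx_irreducible T -> (1 < i)%N ->
    (forall x, x \in G -> exists a, v *m T x = a *: v) -> v = 0.
  move=> irrT i_gt1 vT; apply: (irr_no_line irrT i_gt1).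
  apply/mxmoduleP => x Gx.
  by have [a ->] := vT x Gx; apply: scalemx_sub.
rewrite (line_i _ T1 (lsubmx u)) // => [|x /uE[a]]; last first.
  rewrite mul_row_block !mulmx0 addr0 add0r scale_row_mx => /eq_row_mx[-> _].
  by exists a.
rewrite (line_i _ T2 (rsubmx u)) ?row_mx0 // => x /uE[a].
rewrite mul_row_block !mulmx0 addr0 add0r scale_row_mx => /eq_row_mx[_ ->].
by exists a.
Qed.

(** The eigenvalue of an orthogonal matrix on an invariant line is a sign. *)
Definition keeps_line n (w : 'rV[int]_n) (A : 'M[int]_n) :=
  w *m A = w \/ w *m A = - w.

Lemma keeps_lineM n (w : 'rV[int]_n) A B :
  keeps_line w A -> keeps_line w B -> keeps_line w (A *m B).
Proof.
rewrite /keeps_line mulmxA => -[]->; [|rewrite mulNmx] => -[]->;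
  by rewrite ?opprK; auto.
Qed.

Lemma hyperoct_repr_no_line (gT : finGroupType) (I : {group gT}) (g2 g3 : gT)
    (R : realType) (T1 T2 : mx_representation R I 3) n
    (phi : {morphism I >-> 'B_n}) (w : 'rV[int]_n) :
    <<[set g2; g3]>>%g = I -> mx_irreducible T1 -> mx_irreducible T2 ->
    mx_rsim (hyperoct_repr R phi)
      (dadd_grepr (Representation T1) (Representation T2)) ->
  keeps_line w (phi g2) -> keeps_line w (phi g3) -> w = 0.
Proof.
move=> defI irr1 irr2 sim w2 w3.
pose wR : 'rV[R]_n := map_mx intr w; suff: wR = 0.
  move=> w0; apply/rowP => j; apply: (@intr_inj R).
  by have /rowP/(_ j) := w0; rewrite !mxE.
apply: (dadd_no_line irr1 _ irr2 _ sim) => //.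
have sub_w (g : gT) : keeps_line w (phi g) ->
    (wR *m hyperoct_repr R phi g <= wR)%MS.
  by rewrite /= /wR -map_mxM => -[]->; rewrite ?map_mxN ?eqmx_opp ?submx_refl.
have [I2 I3] : g2 \in I /\ g3 \in I.
  by rewrite -defI !mem_gen // !inE eqxx ?orbT.
have: [set g2; g3] \subset rstabs (hyperoct_repr R phi) wR.
  by rewrite subUset !sub1set !inE I2 I3 !sub_w.
by rewrite -gen_subG defI.
Qed.

Definition row_of (v : seq int) : 'rV[int]_6 := \row_j nth 0 v j.

Lemma row_of_act v c :
  is_code 6 c -> row_of (row_act v c) = row_of v *m code_mx 6 c.
Proof.
move=> cc; apply/rowP => j.
rewrite !mxE (nth_map (0%N, false)) ?(size_code cc) //=.
rewrite (bigD1 (Ordinal (code_lt cc (ltn_ord j)))) //= big1 => [|k neq_k].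
  by rewrite !mxE /= eqxx addr0; case: (_.2); rewrite ?mulr1 ?mulrN1.
rewrite !mxE /= [X in _ * X]ifN ?mulr0 //; apply: contra neq_k => /eqP def_k.
by apply/eqP/val_inj.
Qed.

End Lines.

Lemma line_keeps v (A : 'B_6) :
  keeps_line_code v (enc A) -> keeps_line (row_of v) A.
Proof.
have rowN (u : seq int) : row_of [seq (- x)%R | x : int <- u] = (- row_of u)%R.
  apply/rowP => j; rewrite !mxE; case: (ltnP j (size u)) => [lt_j|ge_j].
    by rewrite (nth_map 0%R).
  by rewrite !nth_default ?size_map ?oppr0.
rewrite /keeps_line -[X in (_ *m X)%R]encK -row_of_act ?enc_code //.
by case/orP=> /eqP->; [left | right].
Qed.

(** By Sylow's theorem a conjugate of x * y is a power of the standard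
    five-fold rotation r, and [involution_cases] applies to the corresponding
    conjugate a of x. An invariant line of a and r would give one of x and y,
    by transport back along the conjugation. *)
Lemma conj_ico (H : {group 'B_6}) (x y : 'B_6) :
    <<[set x; y]>> = H -> #|H| = 60 -> x ^+ 2 = 1 -> y ^+ 3 = 1 ->
    (x * y) ^+ 5 = 1 -> x * y != 1 ->
    (forall w : 'rV[int]_6, keeps_line w x -> keeps_line w y -> w = 0%R) ->
  (H : {set 'B_6}) \in conj_class ico.
Proof.
move=> defH cH x2 y3 xy5 nt_xy no_line; set c := x * y in xy5 nt_xy.
have oc : #[c] = 5 by apply: nt_prime_order.
have def_y : y = x * c by rewrite mulgA -[x * x]/(x ^+ 2) x2 mul1g.
have [r Ir er] := ico_rot5; have or : #[r] = 5.
  apply: nt_prime_order => //; last by rewrite -enc_eq er enc1.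
  by apply: (@enc_inj 6); rewrite encX er enc1.
have sylow5 z : #[z] = 5 -> 5.-Sylow([set: 'B_6]) <[z]>.
  by move=> oz; rewrite pHallE subsetT card_B6 -orderE oz p_part.
have [h _ def_c] := Sylow_trans (sylow5 r or) (sylow5 c oc).
have /cyclePmin[k lt_k ck]: c ^ h^-1 \in <[r]>.
  by rewrite -mem_conjg -def_c cycle_id.
rewrite or in lt_k; set a := x ^ h^-1.
have ya : y ^ h^-1 = a * r ^+ k by rewrite def_y conjMg ck.
have k_in : k \in [:: 1%N; 2; 3; 4].
  case: k lt_k ck {ya} => [|[|[|[|[|k]]]]] // _ /eqP.
  by rewrite expg0 conjg_eq1 (negPf nt_xy).
have H_in (g : 'B_6) : a ^ g \in ico -> r ^ g \in ico ->
    (H : {set 'B_6}) \in conj_class ico.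
  move=> Iag Irg; apply/imsetP; exists (h^-1 * g)^-1; rewrite ?inE //.
  apply: (canRL (conjsgK _)); apply/eqP.
  rewrite eqEcard card_ico cardJg cH leqnn andbT.
  rewrite -defH -genJ gen_subG conjUg !conjg_set1 subUset !sub1set !conjgM ya.
  by rewrite Iag conjMg conjXg groupM ?groupX.
have [|Ia|Ia|/hasP[v v_in va]] := or3P (allP involution_cases (enc a) _).
- rewrite !mem_filter mem_codes enc_code -encM -conjMg -[x * x]/(x ^+ 2) x2.
  rewrite conj1g enc1 eqxx !andbT; apply/hasP; exists k => //.
  by rewrite -er -!encX -encM -encX -ya -conjXg y3 conj1g enc1.
- by apply: (H_in 1); rewrite conjg1 // mem_ico.
- have [f ef] := enc_onto (isT : is_code 6 flip_code).
  apply: (H_in f); rewrite mem_ico encJ ef //.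
  by rewrite er conj_flip_g5 -er -mem_ico.
have keep_r : keeps_line (row_of v) r.
  by apply: line_keeps; rewrite er (allP test_lines_g5).
have keep_a := line_keeps va.
have keep_rk : keeps_line (row_of v) (r ^+ k)%g.
  elim: (k) => [|j IHj]; first by left; rewrite mulmx1.
  by rewrite expgS; apply: (keeps_lineM keep_r IHj).
pose w := (row_of v *m h)%R.
have keepJ (z : 'B_6) : keeps_line (row_of v) (z ^ h^-1)%g -> keeps_line w z.
  have wz : (w *m z = row_of v *m (z ^ h^-1)%g *m h)%R.
    rewrite /w -mulmxA -[RHS]mulmxA; congr (_ *m _)%R.
    exact: (congr1 val (conjgCV h z)).
  by rewrite /keeps_line wz => -[]->; rewrite ?mulNmx; auto.
have w0 : w = 0%R.
  apply: no_line; apply: keepJ => //.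
  by rewrite ya; apply: (keeps_lineM keep_a keep_rk).
have: row_of v = 0%R.
  rewrite -[row_of v]mulmx1 -[(1%:M)%R]/(val (1 : 'B_6)) -(mulgV h).
  by rewrite mulmxA -/w w0 mul0mx.
(* The last coordinate of each of the test lines is nonzero. *)
move/rowP/(_ ord_max); rewrite !mxE => /eqP.
by move: v_in; rewrite !inE => /or3P[]/eqP->.
Qed.

(** * Degrees of the graphs *)

Section ConjClass.
Variable gT : finGroupType.
Implicit Types (A B K : {set gT}).

Lemma mem_conj_classJ A B g : (B :^ g \in conj_class A) = (B \in conj_class A).
Proof.
apply/imsetP/imsetP => -[h _ defB].
  by exists (h * g^-1); rewrite ?inE // conjsgM -defB conjsgK.
by exists (h * g); rewrite ?inE // conjsgM defB.
Qed.

Lemma card_conj_class A B : B \in conj_class A -> #|B| = #|A|.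
Proof. by case/imsetP => g _ ->; apply: cardJg. Qed.

Lemma Ggraph_adjJ K A B g : Ggraph_adj K (A :^ g) (B :^ g) = Ggraph_adj K A B.
Proof.
by rewrite /Ggraph_adj -conjIg mem_conj_classJ (inj_eq (@conjsg_inj _ g)).
Qed.

Lemma Ggraph_regular A K :
  regular_of_degree (conj_class A) (Ggraph_adj K)
    (degree (conj_class A) (Ggraph_adj K) A).
Proof.
move=> _ /imsetP[g _ ->]; rewrite /degree.
rewrite -[RHS](card_imset _ (@conjsg_inj _ g)).
apply: eq_card => B; apply/idP/imsetP => [|[C + ->]].
  rewrite inE -(conjsgKV g B) mem_conj_classJ Ggraph_adjJ => adjB.
  by exists (B :^ g^-1); rewrite // inE.
by rewrite !inE mem_conj_classJ Ggraph_adjJ.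
Qed.

(** The condition on orders keeps A itself out of the left-hand set. *)
Lemma degree_neighbours K (V : {set {set gT}}) A : #|A| != #|K| ->
  #|[set B in V | [exists P in conj_class K, A :&: B == P]]| =
    degree V (Ggraph_adj K) A.
Proof.
move=> neq_AK; apply: eq_card => B; rewrite !inE /Ggraph_adj; congr (_ && _).
apply/exists_inP/andP => [[P KP /eqP AB] | [_ KAB]]; last by exists (A :&: B).
split; last by rewrite AB.
apply: contraNneq neq_AK => eqAB; rewrite -{}eqAB setIid in AB.
by rewrite AB (card_conj_class KP).
Qed.

End ConjClass.

(** The neighbours of the icosahedral group in the graph of J are the conjugates
    that meet it in |J| elements. In order 5 there are none of either, as no
    intersection has that order. *)
Lemma degree_ico (J : {group 'B_6}) n : J \subset ico -> #|J| = n ->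
  n \in [:: 1%N; 2; 3; 4; 5; 6; 10; 12] ->
  degree (conj_class ico) (Ggraph_adj J) ico = count_mem n meet_orders.
Proof.
move=> sJI cJ n_in; rewrite -card_meet_ico.
have [n5 | neq_n5] := eqVneq n 5.
  have no5: #|[set K in conj_class ico | #|ico :&: K| == 5]| = 0.
    by rewrite card_meet_ico.
  rewrite n5 no5; apply/eqP; rewrite -leqn0 -[leqRHS]no5.
  apply/subset_leq_card/subsetP => K.
  by rewrite !inE => /and3P[-> _ /card_conj_class->]; rewrite cJ n5 eqxx.
apply: eq_card => K; rewrite !inE; case classK: (K \in _) => //=.
apply/andP/idP => [[_ /card_conj_class->] | /eqP cIK]; first by rewrite cJ.
have /imsetP[g _ defK] := classK; split.
  by apply: contraTneq n_in => eqK; rewrite -cIK -eqK setIid card_ico.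
rewrite defK in cIK *.
apply: (sub_ico_conj (n := n) (J1 := J) (J2 := (ico :&: ico :^ g)%G)) => //.
  exact: subsetIl.
by move: n_in; rewrite !inE (negPf neq_n5) orFb.
Qed.

Lemma enc_of_columns (A : 'B_6) c : is_code 6 c ->
  (forall j, (j < 6)%N -> (A : 'M[int]_6) *m e6 j.+1 =
     let p := nth (0, false)%N c j in (-1) ^+ p.2 *: e6 p.1.+1)%R -> enc A = c.
Proof.
move=> cc colA; apply: (enc_uniq cc); apply/matrixP => i j.
have eE : e6 j.+1 = delta_mx j 0%R.
  by apply/matrixP => k l; rewrite !mxE eqSS (ord1 l) eqxx andbT val_eqE.
have := colA j (ltn_ord j); rewrite eE -colE => /matrixP/(_ i 0%R).
rewrite !mxE eqSS eq_sym => ->; set p := nth _ c j.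
by rewrite /= mulr_natr mulrb.
Qed.

Lemma enc_icosahedral_images (A2 A3 : 'B_6) :
  icosahedral_images A2 A3 -> enc A2 = code_g2 /\ enc A3 = code_g3.
Proof.
case=> [[a1 a2 a3 a4 [a5 a6]] [b1 b2 b3 b4 [b5 b6]]].
split; apply: enc_of_columns => // -[|[|[|[|[|[|]]]]]] // _.
all: by rewrite /= ?expr0 ?expr1 ?scale1r ?scaleN1r.
Qed.

Theorem proposition5p2
    (gT : finGroupType) (I : {group gT}) (g2 g3 : gT)
    (hI : icosahedral_generators I g2 g3)
    (R : realType) (T1 T2 : mx_representation R I 3)
    (hT1 : mx_irreducible T1) (hT2 : mx_irreducible T2)
    (hT12 : ~ mx_rsim T1 T2)
    (Ihat : {morphism I >-> 'B_6}) (hIhat : 'injm Ihat)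
    (hIhat23 : icosahedral_images (Ihat g2) (Ihat g3))
    (G : {group gT}) (hG : G \proper I) :
  exists d : nat,
    [/\ regular_of_degree (conj_class (Ihat @* I)) (Ggraph_adj (Ihat @* G)) d,
        (forall H : {group 'B_6}, crystallographic T1 T2 H ->
           #|[set K in conj_class (Ihat @* I)
               | [exists P in conj_class (Ihat @* G), H :&: K == P]]| = d)
      & [/\ G \isog 'Alt_('I_4) -> d = 5,
            G \isog 'D_10 -> d = 6,
            G \isog 'D_6 -> d = 10,
            G \isog Zp 5 -> d = 0
          & [/\ G \isog 'D_4 -> d = 30,
                G \isog Zp 3 -> d = 20,
                G \isog Zp 2 -> d = 60
              & G :=: 1 -> d = 60]]].
Proof.
have [isoI genI g2_2 g3_3 g23_5] := hI.
have cI : #|I| = 60.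
  rewrite (card_isog isoI); apply: double_inj.
  by rewrite -mul2n card_Alt card_ord.
have [I2 I3] : g2 \in I /\ g3 \in I.
  by rewrite -genI !mem_gen // !inE eqxx ?orbT.
have morph_gen (phi : {morphism I >-> 'B_6}) :
    phi @* I = <<[set phi g2; phi g3]>>.
  transitivity (phi @* <<[set g2; g3]>>); first by rewrite genI.
  rewrite morphim_gen; last by rewrite subUset !sub1set I2.
  by rewrite morphimU !morphim_set1.
have [e2 e3] := enc_icosahedral_images hIhat23.
have defI : Ihat @* I = ico.
  rewrite morph_gen ico_gen // -morph_gen.
  by rewrite card_injm.
have nt_g23 : g2 * g3 != 1.
  apply: contraTneq isT => g23_1.
  have : enc (Ihat (g2 * g3)) = onec 6 by rewrite g23_1 morph1 enc1.
  by rewrite morphM // encM e2 e3.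
have sGI := proper_sub hG.
have cG : #|Ihat @* G| = #|G| by rewrite card_injm.
have sKI : Ihat @* G \subset ico by rewrite -defI morphimS.
exists (degree (conj_class ico) (Ggraph_adj (Ihat @* G)) ico); rewrite defI.
split; first exact: Ggraph_regular.
  move=> H [phi /isomP[inj_phi defH] sim].
  have cH : #|H| = 60 by rewrite -defH card_injm.
  have classH : (H : {set _}) \in conj_class ico.
    apply: (conj_ico (x := phi g2) (y := phi g3)) => //.
    - by rewrite -morph_gen.
    - by rewrite -morphX // g2_2 morph1.
    - by rewrite -morphX // g3_3 morph1.
    - by rewrite -morphM // -morphX ?groupM // g23_5 morph1.
    - by rewrite -morphM // morph_injm_eq1 ?groupM.
    by move=> w; apply: hyperoct_repr_no_line genI hT1 hT2 sim.
  rewrite degree_neighbours; first exact: Ggraph_regular.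
  by rewrite cH cG -cI neq_ltn (proper_card hG) orbT.
have dE n : #|G| = n -> n \in [:: 1%N; 2; 3; 4; 5; 6; 10; 12] ->
    degree (conj_class ico) (Ggraph_adj (Ihat @* G)) ico =
      count_mem n meet_orders.
  by move=> cGn; apply: degree_ico; rewrite // cG.
split; last split.
- move=> isoG; rewrite (dE 12) // (card_isog isoG); apply: double_inj.
  by rewrite -mul2n card_Alt card_ord.
- by move=> isoG; rewrite (dE 10) // (card_isog isoG) (@card_dihedral 5).
- by move=> isoG; rewrite (dE 6) // (card_isog isoG) (@card_dihedral 3).
- by move=> isoG; rewrite (dE 5) // (card_isog isoG) card_Zp.
- by move=> isoG; rewrite (dE 4) // (card_isog isoG) (@card_dihedral 2).
- by move=> isoG; rewrite (dE 3) // (card_isog isoG) card_Zp.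
- by move=> isoG; rewrite (dE 2) // (card_isog isoG) card_Zp.
by move=> G1; rewrite (dE 1%N) // G1 cards1.
Qed.
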